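(* Let $\sigma,\tau_1,\dots,\tau_m\subseteq[n]$ be distinct triangles on $\gamma_3$ whose liftings to $\gamma_4$ are pairwise non-overlapping in $\mathbb{R}^4$. Assume that $\min(\sigma)\le\min(\tau_i)$ for every $i\in[m]$, and that $\min(\sigma)=\min(\tau_i)$ implies $\max(\sigma)\ge\max(\tau_i)$ for every $i\in[m]$. Then there is a triangulation $T\in S(n,3)$ such that $\sigma\in T$ and $\tau_i\le_4T$ for every $i\in[m]$.
   Context: $\gamma_d=\{(t,t^2,\dots,t^d):t\in\mathbb{R}\}$. Fix $t_1<\dots<t_n$ and the points $\gamma_3(t_i)$, identified with $i\in[n]$ (so $\min,\max$ refer to this order); $C(n,3)$ is their convex hull and $S(n,3)$ the set of triangulations of $C(n,3)$ with vertices in $[n]$. Simplices are subsets of $[n]$ identified with their convex hulls; the lifting of $\sigma\subseteq[n]$ is $\{\gamma_4(t_i):i\in\sigma\}$. Simplices $\alpha,\beta$ overlap if $\mathrm{conv}(\alpha)\cap\mathrm{conv}(\beta)\supsetneq\mathrm{conv}(\alpha\cap\beta)$. The height function $h_\alpha:\mathrm{conv}(\alpha)\to\mathbb{R}$ gives the last coordinate of the point of the convex hull of the lifting of $\alpha$ projecting to $p$. For $T\in S(n,3)$, $h_T(p)=h_\rho(p)$ for $p\in\mathrm{conv}(\rho)$, $\rho\in T$, and $\tau\le_4T$ means $h_\tau\le h_T$ on $\mathrm{conv}(\tau)$. *)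

(* Defs.v *)
From HB Require Import structures.
From mathcomp Require Import all_boot all_order all_algebra.
Unset Printing Implicit Defensive.
Import Order.TTheory GRing.Theory Num.Theory.
Local Open Scope ring_scope.

Section Cyclic.
Context {R : realFieldType} {n : nat} (t : 'I_n -> R).

Definition gam (d : nat) (x : R) : 'rV[R]_d := \row_(j < d) x ^+ j.+1.

Definition conv_coeffs (alpha : {set 'I_n}) (lam : 'I_n -> R) : Prop :=
  (forall i, 0 <= lam i) /\ (forall i, i \notin alpha -> lam i = 0) /\
  \sum_i lam i = 1.

Definition comb (d : nat) (lam : 'I_n -> R) : 'rV[R]_d :=
  \sum_i lam i *: gam d (t i).

Definition in_conv (d : nat) (alpha : {set 'I_n}) (p : 'rV[R]_d) : Prop :=
  exists lam, conv_coeffs alpha lam /\ p = comb d lam.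

(* alpha, beta overlap (in R^d): conv(alpha) cap conv(beta) strictly contains
   conv(alpha cap beta) (the inclusion "contains" always holds) *)
Definition overlap (d : nat) (alpha beta : {set 'I_n}) : Prop :=
  exists p : 'rV[R]_d, in_conv d alpha p /\ in_conv d beta p /\
                       ~ in_conv d (alpha :&: beta) p.

Definition proj43 (q : 'rV[R]_4) : 'rV[R]_3 :=
  \row_(j < 3) q 0 (widen_ord (leqnSn 3) j).

Definition height (alpha : {set 'I_n}) (p : 'rV[R]_3) (h : R) : Prop :=
  exists lam, conv_coeffs alpha lam /\ proj43 (comb 4 lam) = p /\
              (comb 4 lam) 0 ord_max = h.

Definition triangulation (T : {set {set 'I_n}}) : Prop :=
  (forall rho, rho \in T -> #|rho| = 4%N) /\
  (forall p, in_conv 3 setT p -> exists2 rho, rho \in T & in_conv 3 rho p) /\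
  (forall rho rho', rho \in T -> rho' \in T -> rho != rho' ->
                    ~ overlap 3 rho rho').

Definition simplex_of (sigma : {set 'I_n}) (T : {set {set 'I_n}}) : Prop :=
  exists2 rho, rho \in T & sigma \subset rho.

(* tau <=_4 T : h_tau <= h_T on conv(tau), where h_T(p) = h_rho(p) for
   p in conv(rho), rho in T *)
Definition le4 (tau : {set 'I_n}) (T : {set {set 'I_n}}) : Prop :=
  forall p h, height tau p h ->
  forall rho h', rho \in T -> height rho p h' -> h <= h'.

End Cyclic.

Definition smin {n : nat} (s : {set 'I_n}) : nat := \big[minn/n]_(i in s) (i : nat).
Definition smax {n : nat} (s : {set 'I_n}) : nat := \max_(i in s) (i : nat).

(* Main.v *)
Require Import Defs.
From mathcomp Require Import all_boot all_order all_algebra.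
From mathcomp Require Import zify ring lra.
Import Order.TTheory GRing.Theory Num.Theory.
Local Open Scope ring_scope.

(* Let E be the set of edges bd that no triangle ace among sigma and the tau_i
   crosses, i.e. satisfies a < b < c < d < e.  Because the triangles are
   pairwise not interlaced, E is closed under two operations: ac, bd in E with
   a < b < c < d gives ad in E, and every ac in E with c > a + 1 has some b with
   ab, bc in E.  The triangulation T consists of the tetrahedra with all edges
   in E and no triangle crossed by an edge in E.

   An affine dependence of points on the moment curve in dimension 3 has at
   least four sign changes, so two tetrahedra of T that overlap would contain a
   triangle and an edge crossing it; likewise a point of tau_i above T would
   yield an edge in E crossed by tau_i.  The assumptions on min and max say that
   the edges of sigma are in E, whence sigma in T.

   Every point p lies in a simplex {0, i, i+1, n-1}, all of whose edges are in
   E.  While the current simplex is crossed by an edge in E, a flip of a circuit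
   (ace | bd) within an E-clique represents p at a smaller height; this stops at
   an uncrossed simplex, which is a tetrahedron if p is generic. *)

(** * Graphs of uncrossed edges *)

(** Only comparisons of naturals are kept, so that [lia] does not have to interpret membership and
    edge hypotheses. *)
Ltac olia :=
  repeat match goal with
  | H : is_true ?b |- _ => lazymatch b with leq _ _ => fail | _ => clear H end
  end; lia.

Section Graph.
Local Open Scope nat_scope.
Context {n : nat}.
Implicit Types (i j a b c d e f : 'I_n) (A B rho : {set 'I_n}) (F : {set {set 'I_n}}).

(** The pairs required by [adj_first], [adj_last] and [adj_succ] are the edges of the polytope
    $C(n,3)$, which every triangulation contains. *)
Record persistent (E : rel 'I_n) : Prop := Persistent {
  adj_lt : forall i j, E i j -> i < j;
  adj_first : forall i j, i = 0 :> nat -> i < j -> E i j;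
  adj_last : forall i j, j.+1 = n -> i < j -> E i j;
  adj_succ : forall i j, j = i.+1 :> nat -> E i j;
  adj_cross : forall a b c d, a < b -> b < c -> c < d ->
    E a c -> E b d -> E a d;
  adj_bar : forall a c, E a c -> a.+1 < c -> exists b, E a b /\ E b c }.

Definition clique (E : rel 'I_n) (rho : {set 'I_n}) : Prop :=
  {in rho &, forall i j, i < j -> E i j}.

(** In this pattern (ace | bd) is a circuit of the moment curve in dimension 3: the triangle ace and
    the segment bd meet in their relative interiors. The set [A] is also allowed to be a
    tetrahedron. *)
Definition crosses A b d :=
  [exists a in A, exists c in A, exists e in A, [&& a < b, b < c, c < d & d < e]].

Lemma crossesP A b d : reflect
  (exists a c e, [/\ a \in A, c \in A & e \in A] /\ [/\ a < b, b < c, c < d & d < e])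
  (crosses A b d).
Proof.
apply: (iffP idP) => [/'exists_andP[a [Aa /'exists_andP[c [Ac /'exists_andP[e [Ae]]]]]]|].
  by case/and4P=> *; exists a, c, e.
case=> a [c [e [[Aa Ac Ae] lts]]].
apply/'exists_andP; exists a; split=> //; apply/'exists_andP; exists c; split=> //.
by apply/'exists_andP; exists e; split=> //; apply/and4P.
Qed.

(** Six alternating points form a circuit of the moment curve in dimension 4. The relation is not
    symmetric: the first of the six points lies in [A]. *)
Definition interlaced A B : Prop := exists a b c d e f,
  [/\ a < b, b < c, c < d, d < e & e < f] /\
  [/\ a \in A, c \in A & e \in A] /\ [/\ b \in B, d \in B & f \in B].

Definition uncrossed (F : {set {set 'I_n}}) b d :=
  (b < d) && [forall A in F, ~~ crosses A b d].

Lemma uncrossedPn F b d : b < d -> ~~ uncrossed F b d ->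
  exists2 A, A \in F & crosses A b d.
Proof.
move=> lt_bd; rewrite /uncrossed lt_bd /= => /forall_inPn[A FA /negPn crA].
by exists A.
Qed.

Lemma uncrossedP F b d A : uncrossed F b d -> A \in F -> ~~ crosses A b d.
Proof. by case/andP=> _ /forall_inP; apply. Qed.

(** Let b be the last vertex below c joined to a; a+1 is a candidate. If a triangle pqr crossed bc,
    then aq would be crossed by some xyz, by the choice of b. As ac and ab are uncrossed, this
    forces x < p < y < q < z < r, an interlaced pair. *)
Lemma uncrossed_bar F a c : {in F &, forall A B, ~ interlaced A B} ->
  uncrossed F a c -> a.+1 < c ->
  exists b, uncrossed F a b /\ uncrossed F b c.
Proof.
move=> noF Eac ltac; have lt_c := ltn_ord c.
have lt_a1 : a.+1 < n by olia.
have Ea1 : uncrossed F a (Ordinal lt_a1).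
  apply/andP; split; first by rewrite /=.
  apply/forall_inP => A FA; apply/negP => /crossesP[x [y [z [_ []]]]] /=; olia.
pose P b := uncrossed F a b && (b < c).
have Pa1 : P (Ordinal lt_a1) by rewrite /P Ea1.
case: (arg_maxnP (fun b : 'I_n => b : nat) Pa1) => b /andP[Eab lt_bc] maxb.
have lt_ab : a < b by case/andP: Eab.
case: (boolP (uncrossed F b c)) => [|nEbc]; first by exists b.
have [B FB /crossesP[p [q [r [[Bp Bq Br] [lpb lbq lqc lcr]]]]]] := uncrossedPn _ _ _ lt_bc nEbc.
have le_ap : a <= p.
  rewrite leqNgt; apply/negP => lt_pa.
  by case/negP: (uncrossedP _ _ _ _ Eac FB); apply/crossesP; exists p, q, r; split=> //; split; olia.
have nEaq : ~~ uncrossed F a q.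
  apply/negP => Eaq; have /maxb : P q by rewrite /P Eaq.
  by olia.
have lt_aq : a < q by olia.
have [C FC /crossesP[x [y [z [[Cx Cy Cz] [lxa lay lyq lqz]]]]]] := uncrossedPn _ _ _ lt_aq nEaq.
have le_zc : z <= c.
  rewrite leqNgt; apply/negP => lt_cz.
  by case/negP: (uncrossedP _ _ _ _ Eac FC); apply/crossesP; exists x, y, z; split=> //; split; olia.
exfalso; have [le_yp|lt_py] := leqP y p.
  by case/negP: (uncrossedP _ _ _ _ Eab FC); apply/crossesP; exists x, y, z; split=> //; split; olia.
by apply: (noF C B) => //; exists x, p, y, q, z, r; split=> //; split=> //; olia.
Qed.

Lemma uncrossed_persistent F : {in F &, forall A B, ~ interlaced A B} ->
  persistent (uncrossed F).
Proof.
move=> noF; split.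
- by move=> i j /andP[].
- move=> i j i0 lt_ij; rewrite /uncrossed lt_ij; apply/forall_inP => A _.
  by apply/negP => /crossesP[x [y [z [_ []]]]]; olia.
- move=> i j jn lt_ij; rewrite /uncrossed lt_ij; apply/forall_inP => A _.
  apply/negP => /crossesP[x [y [z [_ []]]]]; have := ltn_ord z; olia.
- move=> i j ji; apply/andP; split; first olia.
  by apply/forall_inP => A _; apply/negP => /crossesP[x [y [z [_ []]]]]; olia.
- move=> a b c d ab bc cd Eac Ebd; apply/andP; split; first olia.
  apply/forall_inP => A FA; apply/negP => /crossesP[x [y [z [[Ax Ay Az] [xa ay yd dz]]]]].
  (* The middle vertex y of a triangle crossing ad lies below c or above b, so the triangle already
     crosses ac or bd. *)
  have [lt_yc|le_cy] := ltnP y c.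
    by case/negP: (uncrossedP _ _ _ _ Eac FA); apply/crossesP; exists x, y, z; split=> //; split; olia.
  by case/negP: (uncrossedP _ _ _ _ Ebd FA); apply/crossesP; exists x, y, z; split=> //; split; olia.
- by move=> a c; apply: uncrossed_bar.
Qed.

Context {E : rel 'I_n} (pE : persistent E).

(** If ab is not an edge, let b1 be the first neighbour of a above b. The vertex b2 given by
    [adj_bar] for a b1 lies below b by minimality, and [adj_cross] on b2 b1 and bc yields b2 c. *)
Lemma adj_refine_left a b c : a < b -> E a c -> E b c ->
  exists b', [/\ a < b', b' <= b, E a b' & E b' c].
Proof.
move=> ab Eac Ebc; have bc := adj_lt _ pE _ _ Ebc.
case: (boolP (E a b)) => [Eab|nEab]; first by exists b.
pose P x := E a x && (b < x).
have Pc : P c by rewrite /P Eac.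
case: (arg_minnP (fun x : 'I_n => x : nat) Pc) => b1 /andP[Eab1 bb1] minb1.
have le_b1c : b1 <= c by apply: minb1.
have [|b2 [Eab2 Eb21]] := adj_bar _ pE _ _ Eab1; first olia.
have lt_b21 := adj_lt _ pE _ _ Eb21; have lt_ab2 := adj_lt _ pE _ _ Eab2.
have lt_b2b : b2 < b.
  rewrite ltn_neqAle; apply/andP; split.
    by apply: contraNneq nEab => /val_inj <-.
  rewrite leqNgt; apply/negP => lt_bb2; have /minb1 : P b2 by rewrite /P Eab2.
  by olia.
exists b2; split=> //; first olia.
have [lt_b1c|ge_b1c] := ltnP b1 c.
  exact: (adj_cross _ pE b2 b b1 c).
by have <- : b1 = c by apply/val_inj/eqP; rewrite eqn_leq le_b1c.
Qed.

(** Mirror image of [adj_refine_left]. *)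
Lemma adj_refine_right c d e : d < e -> E c e -> E c d ->
  exists d', [/\ d <= d', d' < e, E c d' & E d' e].
Proof.
move=> de Ece Ecd; have cd := adj_lt _ pE _ _ Ecd.
case: (boolP (E d e)) => [Ede|nEde]; first by exists d.
pose P x := E x e && (x < d).
have Pc : P c by rewrite /P Ece.
case: (arg_maxnP (fun x : 'I_n => x : nat) Pc) => d1 /andP[Ed1e d1d] maxd1.
have le_cd1 : c <= d1 by apply: maxd1.
have [|d2 [Ed12 Ed2e]] := adj_bar _ pE _ _ Ed1e; first olia.
have lt_d12 := adj_lt _ pE _ _ Ed12; have lt_d2e := adj_lt _ pE _ _ Ed2e.
have lt_dd2 : d < d2.
  rewrite ltn_neqAle; apply/andP; split.
    by apply: contraNneq nEde => /val_inj ->.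
  rewrite leqNgt; apply/negP => lt_d2d; have /maxd1 : P d2 by rewrite /P Ed2e.
  by olia.
exists d2; split=> //; first olia.
have [lt_cd1|ge_cd1] := ltnP c d1.
  exact: (adj_cross _ pE c d1 d d2).
by have -> : c = d1 by apply/val_inj/eqP; rewrite eqn_leq le_cd1.
Qed.

(* If [rho] has an element below the predecessor of [c], that predecessor serves
   as [b'], otherwise the vertex given by [adj_refine_left]. *)
Lemma clique_attach_left rho b c : clique E rho -> c \in rho -> E b c ->
  {in rho, forall f, f < c -> f <= b} -> (exists2 f, f \in rho & f < b) ->
  exists a' b', [/\ a' \in rho, a' < b', b' <= b, E b' c &
    {in rho, forall f, f < c -> f = b' \/ E f b'}].
Proof.
move=> cl rc Ebc nob [f0 rf0 f0b]; have bc := adj_lt _ pE _ _ Ebc.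
pose P x := (x \in rho) && (x < c).
have Pf0 : P f0 by rewrite /P rf0; olia.
case: (arg_maxnP (fun x : 'I_n => x : nat) Pf0) => a /andP[ra ac] maxa.
have le_ab := nob _ ra ac.
have [/existsP[f /andP[rf fa]]|/existsPn nof] := boolP [exists f, (f \in rho) && (f < a)].
  exists f, a; split=> //; first exact: cl.
  move=> g rg gc; have le_ga : g <= a by apply: maxa; rewrite /P rg.
  move: le_ga; rewrite leq_eqVlt => /predU1P[/val_inj|]; first by left.
  by right; apply: cl.
have fa0 : a = f0.
  have le_fa : f0 <= a by apply: maxa.
  by apply/val_inj/eqP; rewrite eqn_leq le_fa andbT leqNgt; have := nof f0; rewrite rf0.
have lt_ab : a < b by rewrite fa0.
have [b' [ab' b'b Eab' Eb'c]] := adj_refine_left _ _ _ lt_ab (cl _ _ ra rc ac) Ebc.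
exists a, b'; split=> // g rg gc; right.
have le_ga : g <= a by apply: maxa; rewrite /P rg.
have -> // : g = a.
by apply/val_inj/eqP; rewrite eqn_leq le_ga leqNgt; have := nof g; rewrite rg.
Qed.

(** Mirror image of [clique_attach_left]. *)
Lemma clique_attach_right rho c d : clique E rho -> c \in rho -> E c d ->
  {in rho, forall f, c < f -> d <= f} -> (exists2 f, f \in rho & d < f) ->
  exists d' e', [/\ e' \in rho, d <= d', d' < e', E c d' &
    {in rho, forall f, c < f -> f = d' \/ E d' f}].
Proof.
move=> cl rc Ecd nod [f0 rf0 df0]; have cd := adj_lt _ pE _ _ Ecd.
pose P x := (x \in rho) && (c < x).
have Pf0 : P f0 by rewrite /P rf0; olia.
case: (arg_minnP (fun x : 'I_n => x : nat) Pf0) => e /andP[re ce] mine.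
have le_de := nod _ re ce.
have [/existsP[f /andP[rf ef]]|/existsPn nof] := boolP [exists f, (f \in rho) && (e < f)].
  exists e, f; split=> //; first exact: cl.
  move=> g rg cg; have le_eg : e <= g by apply: mine; rewrite /P rg.
  move: le_eg; rewrite leq_eqVlt => /predU1P[/val_inj|]; first by left.
  by right; apply: cl.
have fe0 : e = f0.
  have le_fe : e <= f0 by apply: mine.
  by apply/val_inj/eqP; rewrite eqn_leq le_fe leqNgt; have := nof f0; rewrite rf0.
have lt_de : d < e by rewrite fe0.
have [d' [dd' d'e Ecd' Ed'e]] := adj_refine_right _ _ _ lt_de (cl _ _ rc re ce) Ecd.
exists d', e; split=> // g rg cg; right.
have le_eg : e <= g by apply: mine; rewrite /P rg.
have -> // : g = e.
by apply/val_inj/eqP; rewrite eqn_leq le_eg andbT leqNgt; have := nof g; rewrite rg.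
Qed.

(** Induction on the length of bd. The vertex x from [adj_bar] splits bd into two edges, and one of
    them is still crossed unless x is the only vertex of [rho] strictly between b and d. *)
Lemma crosses_innermost rho b d : E b d -> crosses rho b d ->
  exists b' c d', [/\ c \in rho, E b' d', E b' c & E c d'] /\
    [/\ exists2 f, f \in rho & f < b', exists2 f, f \in rho & d' < f &
        {in rho, forall f, b' < f -> f < d' -> f = c}].
Proof.
have [k] := ubnP (d - b); elim: k b d => // k IH b d lek Ebd.
case/crossesP=> a [c [e [[ra rc re] [ab bc cd de]]]].
have [|x [Ebx Exd]] := adj_bar _ pE _ _ Ebd; first olia.
have bx := adj_lt _ pE _ _ Ebx; have xd := adj_lt _ pE _ _ Exd.
case: (ltngtP x c) => [xc|cx|/val_inj xc].
- by apply: (IH x d) => //; [olia | apply/crossesP; exists a, c, e; split=> //; split; olia].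
- by apply: (IH b x) => //; [olia | apply/crossesP; exists a, c, e; split=> //; split; olia].
have [/existsP[y /and4P[ry by_ yd yc]]|/existsPn noy] :=
  boolP [exists y, [&& y \in rho, b < y, y < d & y != c]].
  case: (ltngtP y c) => [lyc|lcy|/val_inj E0]; last by rewrite E0 eqxx in yc.
    by apply: (IH b c); [olia | rewrite -xc | apply/crossesP; exists a, y, e; split=> //; split; olia].
  by apply: (IH c d); [olia | rewrite -xc | apply/crossesP; exists a, y, e; split=> //; split; olia].
exists b, c, d; rewrite -{2 3}xc; split=> //; split; [by exists a | by exists e|].
move=> f rf bf fd; apply/eqP; have := noy f.
by rewrite rf bf fd /= negbK.
Qed.

(* The edge can be moved so that the flip of the circuit [a c e | b d] stays
   inside a clique. *)
Lemma clique_flip rho b d : clique E rho -> E b d -> crosses rho b d ->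
  exists a b' c d' e, [/\ a \in rho, c \in rho & e \in rho] /\
    [/\ a < b', b' < c, c < d' & d' < e] /\ clique E (b' |: (d' |: rho)).
Proof.
move=> cl Ebd0 /(crosses_innermost _ _ _ Ebd0) {b d Ebd0}
  [b [c [d [[rc Ebd Ebc Ecd] [hb hd only_c]]]]].
have bc := adj_lt _ pE _ _ Ebc; have cd := adj_lt _ pE _ _ Ecd.
have [|a [b' [ra ab' b'b Eb'c attb]]] := clique_attach_left _ _ _ cl rc Ebc _ hb.
  move=> f rf fc; rewrite leqNgt; apply/negP => bf.
  have fd : f < d by olia.
  by have := only_c f rf bf fd => E0; rewrite E0 ltnn in fc.
have [|d' [e [re dd' d'e Ecd' attd]]] := clique_attach_right _ _ _ cl rc Ecd _ hd.
  move=> f rf fc; rewrite leqNgt; apply/negP => fd.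
  have bf : b < f by olia.
  by have := only_c f rf bf fd => E0; rewrite E0 ltnn in fc.
have b'c : b' < c by olia.
have cd' : c < d' by olia.
exists a, b', c, d', e; do 2 split=> //.
have Eb'd : E b' d.
  move: b'b; rewrite leq_eqVlt => /predU1P[/val_inj -> //|b'b].
  exact: (adj_cross _ pE b' b c d).
have Eb'd' : E b' d'.
  move: dd'; rewrite leq_eqVlt => /predU1P[/val_inj <- //|dd'].
  exact: (adj_cross _ pE b' c d d').
(* Below c, [attb] provides the edge to b'. For f above c, [adj_cross] combines b'd' and cf into
   b'f. *)
have adjb f : f \in rho -> [/\ f < b' -> E f b' & b' < f -> E b' f].
  move=> rf; case: (ltngtP f c) => [fc|cf|/val_inj ->]; last by split=> //; olia.
    case: (attb f rf fc) => [->|Efb]; first by split; rewrite ltnn.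
    by split=> //; have := adj_lt _ pE _ _ Efb; olia.
  split; first olia; move=> _.
  case: (attd f rf cf) => [->|Edf] //.
  by apply: (adj_cross _ pE b' c d' f); rewrite ?(adj_lt _ pE _ _ Edf) // ; apply: cl.
have adjd f : f \in rho -> [/\ f < d' -> E f d' & d' < f -> E d' f].
  move=> rf; case: (ltngtP f c) => [fc|cf|/val_inj ->]; last by split=> //; olia.
    split; last olia; move=> _.
    case: (attb f rf fc) => [->|Efb] //.
    by apply: (adj_cross _ pE f b' c d'); rewrite ?(adj_lt _ pE _ _ Efb) // ; apply: cl.
  case: (attd f rf cf) => [->|Edf]; first by split; rewrite ltnn.
  by split=> //; have := adj_lt _ pE _ _ Edf; olia.
move=> x y; rewrite !inE => /or3P[/eqP->|/eqP->|rx] /or3P[/eqP->|/eqP->|ry] //;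
  rewrite ?ltnn //; try olia.
- by case: (adjb y ry).
- by case: (adjd y ry).
- by case: (adjb x rx).
- by case: (adjd x rx).
- exact: cl.
Qed.

End Graph.

(** * Moments and sign changes *)

Section Moments.
Context {R : realFieldType} {n : nat} (t : 'I_n -> R).
Context (ht : forall i j : 'I_n, (i < j)%N -> t i < t j).
Implicit Types (l m w : 'I_n -> R) (Q : {poly R}) (rho : {set 'I_n}).

Definition mom (k : nat) l : R := \sum_i l i * t i ^+ k.

Lemma momE k l : mom k l = \sum_i l i * t i ^+ k.
Proof. by []. Qed.

(** Moment 0 is the total mass and moments 1 to 3 are the coordinates in dimension 3; [mom 4] is the
    height of the lifting. *)
Definition same_mom l m : Prop := forall k, (k < 4)%N -> mom k l = mom k m.

Definition supp l : {set 'I_n} := [set i | l i != 0].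

Lemma sum_horner l Q : \sum_i l i * Q.[t i] = \sum_(k < size Q) Q`_k * mom k l.
Proof.
under eq_bigr do rewrite horner_coef mulr_sumr.
rewrite exchange_big; apply: eq_bigr => k _; rewrite mulr_sumr.
by apply: eq_bigr => i _; rewrite mulrCA.
Qed.

Lemma same_mom_horner l m Q : same_mom l m -> (size Q <= 4)%N ->
  \sum_i l i * Q.[t i] = \sum_i m i * Q.[t i].
Proof.
move=> lm sQ; rewrite !sum_horner; apply: eq_bigr => k _.
by rewrite lm // (leq_trans (ltn_ord k)).
Qed.

Lemma momD k l m : mom k (fun i => l i + m i) = mom k l + mom k m.
Proof. by rewrite /mom -big_split; apply: eq_bigr => i _; rewrite mulrDl. Qed.

Lemma momZ k a l : mom k (fun i => a * l i) = a * mom k l.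
Proof. by rewrite /mom mulr_sumr; apply: eq_bigr => i _; rewrite mulrA. Qed.

Lemma momB k l m : mom k (fun i => l i - m i) = mom k l - mom k m.
Proof. by rewrite /mom -sumrB; apply: eq_bigr => i _; rewrite mulrBl. Qed.

Lemma mom_delta k a : mom k (fun i => (i == a)%:R) = t a ^+ k.
Proof.
rewrite /mom (bigD1 a) //= eqxx mul1r big1 ?addr0 // => i /negbTE->.
by rewrite mul0r.
Qed.

Lemma t_inj : injective t.
Proof.
by move=> i j tij; case: (ltngtP i j) => [/ht|/ht|/val_inj //]; rewrite tij ltxx.
Qed.

(** These values serve as roots in sign arguments. They are midpoints of consecutive nodes, or lie
    beyond a bound on all nodes when k is at an end of the range. *)
Lemma separator (k : nat) : exists r, forall i : 'I_n,
  if (i < k)%N then t i < r else r < t i.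
Proof.
pose M := \sum_i `|t i|.
have leM i : `|t i| <= M.
  by rewrite /M (bigD1 i) //= lerDl sumr_ge0.
case: k => [|k].
  exists (- M - 1) => i /=; have := leM i; rewrite ler_norml => /andP[]; lra.
have [nk|kn] := leqP n k.+1.
  exists (M + 1) => i; rewrite (leq_trans (ltn_ord i) nk).
  by have := leM i; rewrite ler_norml => /andP[]; lra.
pose j := Ordinal kn; pose i0 := Ordinal (ltnW kn).
have lt_ij : t i0 < t j by apply: ht.
exists ((t i0 + t j) / 2%:R) => i; rewrite ltnS; case: leqP => [le_ik|lt_ki].
  have : t i <= t i0.
    move: le_ik; rewrite leq_eqVlt => /predU1P[E|lt]; last exact/ltW/ht.
    by have -> : i = i0 by apply: val_inj.
  by lra.
have : t j <= t i.
  move: lt_ki; rewrite leq_eqVlt => /predU1P[E|lt]; last exact/ltW/ht.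
  by have -> : i = j by apply: val_inj.
by lra.
Qed.

Fixpoint alternates (k : nat) (s : R) (lo : nat) l : Prop :=
  if k is k'.+1 then
    exists i : 'I_n, [/\ (lo <= i)%N, 0 < s * l i & alternates k' (- s) i.+1 l]
  else True.

(* Induction on the number of sign changes: each one contributes a root placed
   just before the first entry with the new sign. *)
Lemma alternates_poly k (s : R) lo l : s != 0 -> ~ alternates k.+1 s lo l ->
  exists2 Q : {poly R}, Q \is monic /\ size Q = k.+1 & forall i : 'I_n,
    if (i < lo)%N then is_true (0 < (-1) ^+ k * Q.[t i])
    else l i != 0 -> s * (-1) ^+ k * Q.[t i] * l i < 0.
Proof.
elim: k s lo => [|k IH] s lo s0 nalt.
  exists 1; first by rewrite monic1 size_poly1.
  move=> i; rewrite hornerC !mulr1; case: ltnP => // lo_i li0.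
  rewrite lt_neqAle mulf_neq0 //= leNgt; apply/negP => sli.
  by apply: nalt; exists i.
pose P (i : 'I_n) := (lo <= i)%N && (0 < s * l i).
have [/existsP[i1 Pi1]|/existsPn noi] := boolP [exists i, P i]; last first.
  (* No entry of sign [s] remains, so all k+1 roots are placed beyond the last node, where they
     cause no sign change. *)
  have [r hr] := separator n.
  exists (('X - r%:P) ^+ k.+1).
    by rewrite monic_exp ?monicXsubC // size_exp_XsubC.
  move=> i; have := hr i; rewrite ltn_ord => tr.
  rewrite horner_exp hornerXsubC.
  have sgn : (-1) ^+ k.+1 * (t i - r) ^+ k.+1 = (r - t i) ^+ k.+1.
    by rewrite -exprMn mulN1r opprB.
  have pos : 0 < (r - t i) ^+ k.+1 by rewrite exprn_gt0 // subr_gt0.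
  case: ltnP => [_|lo_i li0]; first by rewrite sgn.
  rewrite -[s * _ * _]mulrA sgn mulrAC pmulr_llt0 //.
  rewrite lt_neqAle mulf_neq0 //= leNgt.
  by have := noi i; rewrite /P lo_i.
case: (arg_minnP (fun i : 'I_n => i : nat) Pi1) => i /andP[lo_i sli] mini.
have [||Q [mQ sQ] hQ] := IH (- s) i.+1; first by rewrite oppr_eq0.
  by move=> alt; apply: nalt; exists i.
have [r hr] := separator i.
exists (('X - r%:P) * Q).
  rewrite monicMl ?monicXsubC // size_monicM ?monicXsubC ?monic_neq0 //.
  by rewrite size_XsubC sQ.
move=> j; have hj := hr j; have hQj := hQ j.
rewrite hornerM hornerXsubC exprS; set q := Q.[_] in hQj *; set e := _ ^+ k in hQj *.
have [lt_ji|le_ij] := ltnP j i.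
  rewrite lt_ji in hj; rewrite ltnS (ltnW lt_ji) in hQj.
  have pos : 0 < -1 * e * ((t j - r) * q).
    have -> : -1 * e * ((t j - r) * q) = (r - t j) * (e * q) by ring.
    by rewrite mulr_gt0 // subr_gt0.
  case: ltnP => // lo_j lj0.
  have slj : s * l j < 0.
    rewrite lt_neqAle mulf_neq0 //= leNgt; apply/negP => slj.
    by have := mini j; rewrite /P lo_j slj leqNgt lt_ji => /(_ isT).
  have -> : s * (-1 * e) * ((t j - r) * q) * l j =
    (-1 * e * ((t j - r) * q)) * (s * l j) by ring.
  by rewrite pmulr_rlt0.
rewrite ltnNge le_ij /= in hj; rewrite ltnNge (leq_trans lo_i le_ij) /= => lj0.
have -> : s * (-1 * e) * ((t j - r) * q) * l j =
  (t j - r) * (- s * e * q * l j) by ring.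
rewrite pmulr_rlt0 ?subr_gt0 //.
move: hQj; rewrite ltnS; case: leqP => [le_ji eq0|_]; last exact.
have -> : j = i by apply/val_inj/eqP; rewrite eqn_leq le_ji.
have -> : - s * e * q * l i = - ((e * q) * (s * l i)) by ring.
by rewrite oppr_lt0 mulr_gt0.
Qed.

(** The polynomial Q of [alternates_poly] is monic of degree 4, so the sum of the [l i * Q.[t i]] is
    [mom 4 l]. Each term with [l i] nonzero is negative. *)
Lemma mom4_lt0 l : (forall k, (k < 4)%N -> mom k l = 0) -> ~ alternates 5 1 0 l ->
  (exists i, l i != 0) -> mom 4 l < 0.
Proof.
move=> l0 /alternates_poly[|Q [mQ sQ] hQ [i li0]]; first exact: oner_neq0.
have <- : \sum_i l i * Q.[t i] = mom 4 l.
  rewrite sum_horner sQ big_ord_recr big1 /= => [|k _]; last by rewrite l0 ?mulr0.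
  by move: mQ; rewrite monicE lead_coefE sQ /= => /eqP->; rewrite add0r mul1r.
have neg j : l j != 0 -> l j * Q.[t j] < 0.
  by move/(hQ j); rewrite mul1r mulrC (_ : (-1) ^+ 4 = 1) ?mul1r //; ring.
rewrite (bigD1 i) //= ltr_wnDr ?neg //.
apply: sumr_le0 => j _; have [->|/neg/ltW //] := eqVneq (l j) 0.
by rewrite mul0r.
Qed.

Lemma alternates5P (s : R) l : 0 < s -> alternates 5 s 0 l -> exists a b c d e : 'I_n,
  [/\ (a < b)%N, (b < c)%N, (c < d)%N & (d < e)%N] /\
  [/\ 0 < l a, l b < 0, 0 < l c, l d < 0 & 0 < l e].
Proof.
move=> s0 [a [_ la [b [ab lb [c [bc lc [d [cd ld [e [de le _]]]]]]]]]].
exists a, b, c, d, e; split=> //.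
by move: la lb lc ld le; rewrite !opprK !mulNr !oppr_gt0 !pmulr_rgt0 // !pmulr_rlt0.
Qed.

(** Otherwise [mom4_lt0] makes the fourth moments of l - m and of m - l both negative. *)
Lemma same_mom_eq l m : same_mom l m ->
  ~ alternates 5 1 0 (fun i => l i - m i) -> ~ alternates 5 1 0 (fun i => m i - l i) ->
  l =1 m.
Proof.
move=> lm nlm nml i; apply/eqP/contraT => ne.
have ne' : m i != l i by rewrite eq_sym.
have dz k : (k < 4)%N -> mom k l - mom k m = 0 by move=> k4; rewrite lm ?subrr.
have lm4 : mom 4 l - mom 4 m < 0.
  rewrite -momB; apply: mom4_lt0 => // [k k4|]; first by rewrite momB dz.
  by exists i; rewrite subr_eq0.
have : mom 4 m - mom 4 l < 0.
  rewrite -momB; apply: mom4_lt0 => // [k k4|]; last by exists i; rewrite subr_eq0.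
  by rewrite momB -opprB dz ?oppr0.
by rewrite -opprB oppr_lt0 => /(lt_trans lm4); rewrite ltxx.
Qed.

End Moments.

(** * Circuits and flips *)

Section Circuits.
Context {R : realFieldType} {n : nat} (t : 'I_n -> R).
Context (ht : forall i j : 'I_n, (i < j)%N -> t i < t j).
Implicit Types (l m w : 'I_n -> R) (rho : {set 'I_n}).
Local Notation mom := (mom t).
Local Notation same_mom := (same_mom t).

Lemma supp0 l i : i \notin supp l -> l i = 0.
Proof. by rewrite inE negbK => /eqP. Qed.

(* The divided difference at [t a], .., [t e], multiplied by a Vandermonde
   determinant. *)
Lemma circuit (a b c d e : 'I_n) : (a < b)%N -> (b < c)%N -> (c < d)%N -> (d < e)%N ->
  exists w, [/\ forall k, (k < 4)%N -> mom k w = 0, 0 < mom 4 w,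
    forall i, (0 < w i) = (i \in [set a; c; e]) &
    forall i, (w i < 0) = (i \in [set b; d])].
Proof.
move=> ab bc cd de.
have := ht _ _ ab; have := ht _ _ bc; have := ht _ _ cd; have := ht _ _ de.
set ta := t a; set tb := t b; set tc := t c; set td := t d; set te := t e.
move=> tde tcd tbc tab.
pose wa := (tc - tb) * (td - tb) * (te - tb) * (td - tc) * (te - tc) * (te - td).
pose wb := - ((tc - ta) * (td - ta) * (te - ta) * (td - tc) * (te - tc) * (te - td)).
pose wc := (tb - ta) * (td - ta) * (te - ta) * (td - tb) * (te - tb) * (te - td).
pose wd := - ((tb - ta) * (tc - ta) * (te - ta) * (tc - tb) * (te - tb) * (te - tc)).
pose we := (tb - ta) * (tc - ta) * (td - ta) * (tc - tb) * (td - tb) * (td - tc).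
pose w i := wa * (i == a)%:R + (wb * (i == b)%:R + (wc * (i == c)%:R +
  (wd * (i == d)%:R + we * (i == e)%:R))).
have momw k : mom k w = wa * ta ^+ k + (wb * tb ^+ k + (wc * tc ^+ k +
    (wd * td ^+ k + we * te ^+ k))).
  by rewrite /w !momD !momZ !mom_delta.
have [ab' ac' ad' ae'] : [/\ 0 < tb - ta, 0 < tc - ta, 0 < td - ta & 0 < te - ta].
  by split; lra.
have [bc' bd' be'] : [/\ 0 < tc - tb, 0 < td - tb & 0 < te - tb] by split; lra.
have [cd' ce' de'] : [/\ 0 < td - tc, 0 < te - tc & 0 < te - td] by split; lra.
have wa0 : 0 < wa by rewrite !mulr_gt0.
have wb0 : wb < 0 by rewrite oppr_lt0 !mulr_gt0.
have wc0 : 0 < wc by rewrite !mulr_gt0.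
have wd0 : wd < 0 by rewrite oppr_lt0 !mulr_gt0.
have we0 : 0 < we by rewrite !mulr_gt0.
have ne (x y : 'I_n) : (x < y)%N -> ((x == y) = false) * ((y == x) = false).
  by move=> xy; split; rewrite -val_eqE /= ?(gtn_eqF xy) ?(ltn_eqF xy).
have neE := (ne _ _ ab, ne _ _ bc, ne _ _ cd, ne _ _ de, ne _ _ (ltn_trans ab bc),
  ne _ _ (ltn_trans bc cd), ne _ _ (ltn_trans cd de),
  ne _ _ (ltn_trans ab (ltn_trans bc cd)), ne _ _ (ltn_trans bc (ltn_trans cd de)),
  ne _ _ (ltn_trans (ltn_trans ab bc) (ltn_trans cd de))).
have wE i : w i = if i == a then wa else if i == b then wb else if i == c then wc
    else if i == d then wd else if i == e then we else 0.
  rewrite /w; have [->|_] := eqVneq i a; first by rewrite !neE mulr1 !mulr0 !addr0.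
  have [->|_] := eqVneq i b; first by rewrite !neE mulr1 !mulr0 !addr0 add0r.
  have [->|_] := eqVneq i c; first by rewrite !neE mulr1 !mulr0 !addr0 !add0r.
  have [->|_] := eqVneq i d; first by rewrite !neE mulr1 !mulr0 !addr0 !add0r.
  by case: (eqVneq i e) => _; rewrite ?mulr1 !mulr0 ?addr0 ?add0r.
exists w; split.
- by move=> [|[|[|[|//]]]] _; rewrite momw /wa /wb /wc /wd /we; ring.
(* The fourth moment is the Vandermonde determinant of the five nodes. *)
- rewrite momw (_ : _ + _ = (tb - ta) * (tc - ta) * (td - ta) * (te - ta) * wa).
    by rewrite !mulr_gt0.
  by rewrite /wa /wb /wc /wd /we; ring.
- move=> i; rewrite wE !inE.
  have [->|_] := eqVneq i a; first by rewrite wa0.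
  have [->|_] := eqVneq i b; first by rewrite ltNge (ltW wb0) /= !neE ?eqxx //.
  have [->|_] := eqVneq i c; first by rewrite wc0.
  have [->|_] := eqVneq i d; first by rewrite ltNge (ltW wd0) /= !neE ?eqxx //.
  by case: (eqVneq i e); rewrite ?we0 ?ltxx.
- move=> i; rewrite wE !inE.
  have [->|_] := eqVneq i a; first by rewrite ltNge (ltW wa0) /= !neE ?eqxx //.
  have [->|_] := eqVneq i b; first by rewrite wb0.
  have [->|_] := eqVneq i c; first by rewrite ltNge (ltW wc0) /= !neE ?eqxx //.
  case: (eqVneq i d) => [_|_]; first by rewrite wd0.
  by case: (eqVneq i e); rewrite ?ltxx // ltNge (ltW we0).
Qed.

(** The ratio test of the simplex method: [th] is the least [l i / w i] over the indices with [w i]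
    positive. *)
Lemma pivot l w i0 : (forall i, 0 <= l i) -> 0 < w i0 ->
  (forall i, 0 < w i -> 0 < l i) ->
  exists2 th, 0 < th & (forall i, 0 <= l i - th * w i) /\
    exists2 j, 0 < w j & l j - th * w j = 0.
Proof.
move=> l0 wi0 wl.
case: (@Order.TotalTheory.arg_minP _ _ _ i0 (fun i => 0 < w i) (fun i => l i / w i) wi0) => j wj minj.
exists (l j / w j); first by rewrite divr_gt0 // wl.
split; last by exists j; rewrite // divfK ?subrr // gt_eqF.
move=> i; rewrite subr_ge0; have [wi|wi] := ltP 0 (w i).
  by rewrite -ler_pdivlMr //; apply: minj.
by apply: le_trans (l0 i); rewrite mulr_ge0_le0 // divr_ge0 // ltW.
Qed.

(** A multiple of the circuit (ace | bd) is subtracted until a, c or e leaves the support. The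
    height drops because the circuit has positive fourth moment. *)
Lemma flip_down l (a b c d e : 'I_n) : (forall i, 0 <= l i) ->
  (a < b)%N -> (b < c)%N -> (c < d)%N -> (d < e)%N ->
  a \in supp l -> c \in supp l -> e \in supp l ->
  exists m, [/\ forall i, 0 <= m i, same_mom l m, mom 4 m < mom 4 l,
    supp m \subset b |: (d |: supp l) & exists2 j, j \in supp l & m j = 0].
Proof.
move=> l0 ab bc cd de la lc le.
have [w [w0 w4 wpos wneg]] := circuit _ _ _ _ _ ab bc cd de.
have lpos i : i \in supp l -> 0 < l i by rewrite inE lt_neqAle eq_sym l0 andbT.
have wl i : 0 < w i -> i \in supp l.
  by rewrite wpos !inE -orbA => /or3P[] /eqP->; move: la lc le; rewrite !inE.
have [|th th0 [m0 [j wj mj]]] := pivot l w a l0 _ (fun i wi => lpos i (wl i wi)).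
  by rewrite wpos !inE eqxx.
exists (fun i => l i - th * w i); split=> //.
- by move=> k k4; rewrite momB momZ (w0 k k4) mulr0 subr0.
- by rewrite momB momZ gtrDl oppr_lt0 mulr_gt0.
- apply/subsetP => i mi; rewrite !inE; apply/contraT.
  rewrite !negb_or negbK => /and3P[ib id /eqP li].
  have := wneg i; rewrite !inE (negbTE ib) (negbTE id) /= => /negbT; rewrite -leNgt.
  rewrite le_eqVlt => /predU1P[wi|/wl]; last by rewrite inE li eqxx.
  by move: mi; rewrite inE li -wi mulr0 subr0 eqxx.
- by exists j => //; apply: wl.
Qed.

(** The reverse flip: the circuit is added until b or d leaves the support. It is negated as
    [-1 * w] so that [pivot] applies. *)
Lemma flip_up l (a b c d e : 'I_n) : (forall i, 0 <= l i) ->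
  (a < b)%N -> (b < c)%N -> (c < d)%N -> (d < e)%N ->
  b \in supp l -> d \in supp l ->
  exists m, [/\ forall i, 0 <= m i, same_mom l m,
    supp m \subset a |: (c |: (e |: supp l)) & m b = 0 \/ m d = 0].
Proof.
move=> l0 ab bc cd de lb ld.
have [w [w0 w4 wpos wneg]] := circuit _ _ _ _ _ ab bc cd de.
have lpos i : i \in supp l -> 0 < l i by rewrite inE lt_neqAle eq_sym l0 andbT.
have wl i : 0 < -1 * w i -> i \in [set b; d].
  by rewrite mulN1r oppr_gt0 wneg.
have [||th th0 [m0 [j wj mj]]] := pivot l (fun i => -1 * w i) b l0.
- by rewrite mulN1r oppr_gt0 wneg !inE eqxx.
- by move=> i /wl; rewrite !inE => /pred2P[]->; apply: lpos.
exists (fun i => l i - th * (-1 * w i)); split=> //.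
- by move=> k k4; rewrite momB !momZ (w0 k k4) !mulr0 subr0.
- apply/subsetP => i mi; rewrite !inE; apply/contraT.
  rewrite !negb_or negbK => /and4P[ia ic ie /eqP li].
  have := wpos i; rewrite !inE (negbTE ia) (negbTE ic) (negbTE ie) /= => /negbT.
  rewrite -leNgt -oppr_ge0 -mulN1r le_eqVlt => /predU1P[wi|].
    by move: mi; rewrite inE li -wi mulr0 subr0 eqxx.
  by move/wl; rewrite !inE => /pred2P[] E; move: lb ld; rewrite !inE -E li eqxx.
- by have := wl j wj; rewrite !inE => /pred2P[] <-; [left|right].
Qed.

Lemma card_gt_min rho k : (k < #|rho|)%N ->
  exists2 a, a \in rho & (k <= #|[set x in rho | (a < x)%N]|)%N.
Proof.
move=> lk; have [x0 rx0] : exists x, x \in rho.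
  by apply/set0Pn; rewrite -card_gt0 (leq_ltn_trans _ lk).
case: (arg_minnP (fun i : 'I_n => i : nat) rx0) => a ra mina.
have {}ra : a \in rho by [].
exists a => //; rewrite -ltnS (leq_trans lk) // (cardsD1 a) ra add1n ltnS.
apply: subset_leq_card; apply/subsetP => x; rewrite !inE => /andP[xa rx].
by rewrite rx ltn_neqAle mina // andbT val_eqE eq_sym.
Qed.

Lemma card_ge5 rho : (4 < #|rho|)%N -> exists a b c d e : 'I_n,
  [/\ (a < b)%N, (b < c)%N, (c < d)%N & (d < e)%N] /\
  [/\ a \in rho, b \in rho, c \in rho, d \in rho & e \in rho].
Proof.
move=> /card_gt_min[a ra /card_gt_min[b + /card_gt_min[c + /card_gt_min[d +
  /card_gt_min[e + _]]]]]; rewrite !inE.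
case/andP=> rb ab /andP[/andP[rc _] bc] /andP[/andP[/andP[rd _] _] cd].
case/andP=> /andP[/andP[/andP[re _] _] _] de.
by exists a, b, c, d, e.
Qed.

(** Carathéodory's theorem by flips: a support of five or more points contains a whole circuit, and
    flipping it down removes a point, adds none and lowers the height. *)
Lemma reduce_supp l : (forall i, 0 <= l i) ->
  exists m, [/\ forall i, 0 <= m i, same_mom l m, supp m \subset supp l,
    (#|supp m| <= 4)%N & mom 4 m <= mom 4 l].
Proof.
have [k] := ubnP #|supp l|; elim: k l => // k IH l lek l0.
have [le4|/card_ge5] := leqP #|supp l| 4; first by exists l.
case=> a [b [c [d [e [[ab bc cd de] [la lb lc ld le]]]]]].
have [l' [l'0 sl' lt4 sub [j lj l'j]]] := flip_down l a b c d e l0 ab bc cd de la lc le.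
have {}sub : supp l' \subset supp l.
  apply: subset_trans sub _; apply/subsetP => i; rewrite !in_setU1.
  by case/or3P=> [/eqP->|/eqP->|].
have ltk : (#|supp l'| < k)%N.
  rewrite -ltnS (leq_trans _ lek) // ltnS; apply: proper_card.
  by rewrite properE sub; apply/subsetPn; exists j; rewrite // inE l'j eqxx.
have [m [m0 sm subm m4 le_m]] := IH l' ltk l'0.
exists m; split=> //; first by move=> i k4; rewrite sl' ?sm.
  exact: subset_trans subm sub.
exact: le_trans le_m (ltW lt4).
Qed.

(** The simplices {0, k, k+1, n-1} form the upper triangulation of $C(n,3)$. Apart from 0 and n-1,
    the support is kept in a window from b to d; flipping up the circuit (0, b+1, n-1 | b, d) frees
    b or d, and the window shrinks. *)
Lemma upper_supp l : (forall i, 0 <= l i) ->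
  exists m, [/\ forall i, 0 <= m i, same_mom l m &
    exists k, forall i : 'I_n, i \in supp m ->
      [|| i == 0 :> nat, i.+1 == n, i == k :> nat | i == k.+1 :> nat]].
Proof.
pose within l b d := forall i : 'I_n, i \in supp l ->
  [|| i == 0 :> nat, i.+1 == n | (b <= i <= d)%N].
suff H k : forall l b d, (forall i, 0 <= l i) -> within l b d -> (d - b < k)%N ->
    exists m, [/\ forall i, 0 <= m i, same_mom l m &
    exists k, forall i : 'I_n, i \in supp m ->
      [|| i == 0 :> nat, i.+1 == n, i == k :> nat | i == k.+1 :> nat]].
  move=> l0; apply: (H n.+1 l 0 n l0); last by rewrite subn0.
  by move=> i _; rewrite leq0n (ltnW (ltn_ord i)) !orbT.
elim: k => // k IH {}l b d l0 wl lek.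
have [le_db|lt_bd] := leqP d b.+1.
  exists l; split=> //; exists b => i /wl.
  by case/or3P=> [->|->|/andP[bi id]]; rewrite ?orbT //; lia.
have shrinkb : (forall i : 'I_n, i = b :> nat -> i != 0 :> nat -> l i = 0) ->
    within l b.+1 d.
  move=> lb i li; have := wl i li; case: eqP => // i0; case: eqP => //= _.
  case/andP; rewrite leq_eqVlt => /predU1P[E|-> //].
  by move: li; rewrite inE (lb i) ?eqxx //; apply/eqP.
have shrinkd m : within m b d -> (forall i : 'I_n, i = d :> nat -> m i = 0) ->
    within m b d.-1.
  move=> wm ld i li; have := wm i li; case: eqP => //= i0; case: eqP => //= _.
  case/andP=> -> le_id /=; have : i != d :> nat; last by lia.
  by apply/eqP => E; move: li; rewrite inE (ld i) ?eqxx.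
have IHb : within l b.+1 d -> _ := fun wb => IH l b.+1 d l0 wb ltac:(lia).
have IHd : within l b d.-1 -> _ := fun wd => IH l b d.-1 l0 wd ltac:(lia).
have [lt_d|ge_d] := ltnP d.+1 n; last first.
  apply: IHd => i li; have := wl i li; have := ltn_ord i; lia.
have [b0|b_gt0] := posnP b.
  by apply: IHb; apply: shrinkb => i -> ; rewrite b0.
have lt_dn := ltnW lt_d.
have ltbn : (b < n)%N by lia.
have ltb1n : (b.+1 < n)%N by lia.
have lt0n : (0 < n)%N by lia.
have ltn1 : (n.-1 < n)%N by lia.
pose ob := Ordinal ltbn; pose od := Ordinal lt_dn.
have [lb|lb] := boolP (ob \in supp l); last first.
  apply: IHb; apply: shrinkb => i ib _; apply: supp0.
  by have -> : i = ob by apply: val_inj.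
have [ld|ld] := boolP (od \in supp l); last first.
  apply: IHd; apply: shrinkd => // i id; apply: supp0.
  by have -> : i = od by apply: val_inj.
have [||||m [m0 sm subm hm]] := flip_up l (Ordinal lt0n) ob (Ordinal ltb1n) od (Ordinal ltn1) l0 _ _ _ _ lb ld => //=.
  lia.
have wm : within m b d.
  move=> i /(subsetP subm); rewrite !in_setU1 => /or4P[/eqP->|/eqP->|/eqP->|/wl] //=; lia.
have [m' [m'0 sm' hm']] : exists m', [/\ forall i, 0 <= m' i, same_mom m m' &
    exists k, forall i : 'I_n, i \in supp m' ->
      [|| i == 0 :> nat, i.+1 == n, i == k :> nat | i == k.+1 :> nat]].
  case: hm => hm; [apply: (IH m b.+1 d) => // | apply: (IH m b d.-1) => //]; try lia.
    move=> i mi; have := wm i mi; case: eqP => //= i0; case: eqP => //= _.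
    case/andP; rewrite leq_eqVlt => /predU1P[E|-> //].
    have Ei : i = ob by apply: val_inj.
    by move: mi; rewrite inE Ei hm eqxx.
  apply: shrinkd => // i id.
  by have -> : i = od by apply: val_inj.
by exists m'; split=> // j j4; rewrite sm ?sm'.
Qed.

End Circuits.

(** * Covering *)

Section SmallParameter.
Context {R : realFieldType}.
Implicit Types p q : {poly R}.

Lemma horner_bounded p : exists2 C, 0 < C & forall s, 0 < s -> s < 1 -> `|p.[s]| <= C.
Proof.
elim/poly_ind: p => [|p c [C C0 hC]].
  by exists 1 => // s _ _; rewrite horner0 normr0.
exists (C + `|c| + 1); first by have := normr_ge0 c; lra.
move=> s s0 s1; rewrite hornerMXaddC (le_trans (ler_normD _ _)) //.
have : `|p.[s] * s| <= C.
  rewrite normrM (gtr0_norm s0); apply: le_trans (hC s s0 s1).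
  by rewrite ler_piMr // ltW.
lra.
Qed.

(** A vanishing constant term lets X be factored out; a nonzero one dominates the rest near 0. This
    takes the place of a limit argument over an arbitrary ordered field. *)
Lemma horner_near0 p : exists2 u, 0 < u & forall s, 0 < s -> s < u ->
  (p != 0 -> p.[s] != 0) /\ 0 <= p.[0] * p.[s].
Proof.
elim/poly_ind: p => [|p c [u u0 hu]].
  by exists 1 => // s _ _; rewrite eqxx !horner0 mulr0.
have [->|c0] := eqVneq c 0.
  exists u => // s s0 su; rewrite addr0 !hornerMX mulr0 mul0r; split=> //.
  rewrite mulf_eq0 negb_or polyX_eq0 andbT => p0.
  by apply: mulf_neq0; [case: (hu s s0 su) => /(_ p0) | rewrite gt_eqF].
have [C C0 hC] := horner_bounded p.
have cC : 0 < `|c| / C by rewrite divr_gt0 ?normr_gt0.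
exists (Num.min 1 (`|c| / C)); first by rewrite lt_min ltr01.
move=> s s0; rewrite lt_min ltr_pdivlMr // => /andP[s1 sC].
have small : `|p.[s] * s| < `|c|.
  by apply: le_lt_trans sC; rewrite normrM (gtr0_norm s0) mulrC ler_pM2l // hC.
have pos : 0 < c * (p.[s] * s + c).
  rewrite mulrDr -expr2 -real_normK ?num_real // -ltrBlDr sub0r.
  apply: lt_le_trans (_ : - (`|c| * `|p.[s] * s|) <= _).
    by rewrite ltrN2 expr2 ltr_pM2l ?normr_gt0.
  by rewrite lerNl -normrM -normrN ler_norm.
rewrite !hornerMXaddC mulr0 add0r; split; last exact: ltW.
by move=> _; apply: contraTneq pos => ->; rewrite mulr0 ltxx.
Qed.

Lemma horner_near0_seq (ps : seq {poly R}) : exists2 u, 0 < u &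
  {in ps, forall p, (p != 0 -> p.[u] != 0) /\ 0 <= p.[0] * p.[u]}.
Proof.
suff [u u0 hu] : exists2 u, 0 < u & forall s, 0 < s -> s < u ->
    {in ps, forall p, (p != 0 -> p.[s] != 0) /\ 0 <= p.[0] * p.[s]}.
  have u2 : 0 < u / 2%:R by lra.
  by exists (u / 2%:R) => //; apply: hu => //; lra.
elim: ps => [|p ps [u u0 hu]]; first by exists 1.
have [v v0 hv] := horner_near0 p.
exists (Num.min u v); first by rewrite lt_min u0.
move=> s s0; rewrite lt_min => /andP[su sv] q; rewrite inE => /predU1P[->|].
  exact: hv.
exact: hu.
Qed.

End SmallParameter.

(** * Covering points by uncrossed cliques *)

Section Cover.
Context {R : realFieldType} {n : nat} (t : 'I_n -> R).
Context (ht : forall i j : 'I_n, (i < j)%N -> t i < t j).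
Implicit Types (l m w : 'I_n -> R) (rho S : {set 'I_n}).
Local Notation mom := (mom t).
Local Notation same_mom := (same_mom t).

Lemma alternates_supp l m : (forall i, 0 <= l i) -> (forall i, 0 <= m i) ->
  alternates 5 1 0 (fun i => l i - m i) -> exists a b c d e : 'I_n,
  [/\ (a < b)%N, (b < c)%N, (c < d)%N & (d < e)%N] /\
  [/\ a \in supp l, c \in supp l & e \in supp l] /\ b \in supp m /\ d \in supp m.
Proof.
move=> l0 m0 /(alternates5P _ _ ltr01)[a [b [c [d [e [lts [la lb lc ld le]]]]]]].
have pos i : 0 < l i - m i -> i \in supp l.
  by rewrite inE => lm; rewrite gt_eqF //; have := m0 i; lra.
have neg i : l i - m i < 0 -> i \in supp m.
  by rewrite inE => lm; rewrite gt_eqF //; have := l0 i; lra.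
by exists a, b, c, d, e; split=> //; split; [split; apply: pos | split; apply: neg].
Qed.

Lemma card_gt4 S (a b c d e : 'I_n) : (a < b)%N -> (b < c)%N -> (c < d)%N -> (d < e)%N ->
  a \in S -> b \in S -> c \in S -> d \in S -> e \in S -> (4 < #|S|)%N.
Proof.
move=> ab bc cd de aS bS cS dS eS.
have u : uniq [:: a; b; c; d; e].
  rewrite -(map_inj_uniq val_inj); apply: (@sorted_uniq _ ltn ltn_trans ltnn).
  by rewrite /= ab bc cd de.
rewrite -[5%N]/(size [:: a; b; c; d; e]) -(card_uniqP u).
by apply/subset_leq_card/subsetP => x; rewrite !inE => /or4P[||| /orP[]] /eqP->.
Qed.

(** Four points of the moment curve are affinely independent: [S] has no room for five alternating
    signs of l - m. *)
Lemma same_mom_small_supp S l m : (#|S| <= 4)%N ->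
  (forall i, 0 <= l i) -> (forall i, 0 <= m i) ->
  supp l \subset S -> supp m \subset S -> same_mom l m -> l =1 m.
Proof.
move=> S4 l0 m0 /subsetP lS /subsetP mS lm; apply: (same_mom_eq t) => //;
  move=> /alternates_supp[//|//|a [b [c [d [e [[ab bc cd de] [[la lc le] [mb md]]]]]]]];
  by move: S4; rewrite leqNgt (card_gt4 _ _ _ _ _ _ ab bc cd de) //; auto.
Qed.

Context {E : rel 'I_n} (pE : persistent E).

(* Flipping strictly lowers the 4th moment, and a point determines its
   coefficients on each support of size at most 4, so no support recurs. *)
Lemma descend l : (forall i, 0 <= l i) -> clique E (supp l) ->
  exists m, [/\ forall i, 0 <= m i, same_mom l m, clique E (supp m),
    (#|supp m| <= 4)%N & forall b d, E b d -> ~~ crosses (supp m) b d].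
Proof.
have clS (A B : {set 'I_n}) : A \subset B -> clique E B -> clique E A.
  by move=> /subsetP AB cB x y /AB xB /AB yB; apply: cB.
(* [V] holds the supports already visited. Every representation of the point on one of them is
   strictly higher than [l], so [supp l] is new, and the number of unvisited supports decreases. *)
suff H k : forall (V : {set {set 'I_n}}) l, (#|~: V| < k)%N -> (forall i, 0 <= l i) ->
    clique E (supp l) -> (#|supp l| <= 4)%N ->
    (forall m, (forall i, 0 <= m i) -> same_mom l m -> supp m \in V -> mom 4 l < mom 4 m) ->
    exists m, [/\ forall i, 0 <= m i, same_mom l m, clique E (supp m),
      (#|supp m| <= 4)%N & forall b d, E b d -> ~~ crosses (supp m) b d].
  move=> l0 cl; have [l' [l'0 sl sub l4 _]] := reduce_supp _ ht l l0.
  have [|m [m0 sm cm m4 um]] := H _ set0 l' (ltnSn _) l'0 (clS _ _ sub cl) l4.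
    by move=> m _ _; rewrite inE.
  by exists m; split=> // k k4; rewrite sl ?sm.
elim: k => // k IH V {}l lek l0 cl l4 low.
have [/existsP[b /existsP[d /andP[Ebd cr]]]|noc] :=
  boolP [exists b, exists d, E b d && crosses (supp l) b d]; last first.
  exists l; split=> // b d Ebd; apply: contra noc => cr.
  by apply/existsP; exists b; apply/existsP; exists d; rewrite Ebd.
have [a [b' [c [d' [e [[la lc le] [[ab bc cd de] cl']]]]]]] := clique_flip pE _ _ _ cl Ebd cr.
have [m1 [m10 sm1 lt1 sub1 _]] := flip_down _ ht l _ _ _ _ _ l0 ab bc cd de la lc le.
have [m2 [m20 sm2 sub2 card2 le2]] := reduce_supp _ ht m1 m10.
have lt2 : mom 4 m2 < mom 4 l by apply: le_lt_trans lt1.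
have s2 : same_mom l m2 by move=> i i4; rewrite sm1 ?sm2.
have nV : supp l \notin V by apply/negP => /(low l l0 (fun _ _ => erefl)); rewrite ltxx.
have [|||m [m0 sm cm m4 um]] := IH (supp l |: V) m2 _ m20 _ card2.
- rewrite -ltnS (leq_trans _ lek) // ltnS; apply: proper_card.
  by rewrite properC setUC; apply: properUl; rewrite sub1set.
- exact: clS sub2 (clS _ _ sub1 cl').
- move=> m m0 sm; have s : same_mom l m by move=> i i4; rewrite s2 ?sm.
  rewrite in_setU1 => /predU1P[El|mV]; last exact: lt_trans lt2 (low m m0 s mV).
  have lm : l =1 m by apply: (same_mom_small_supp (supp l)) => //; rewrite El.
  by rewrite (_ : mom 4 m = mom 4 l) //; apply: eq_bigr => i _; rewrite lm.
by exists m; split=> // i i4; rewrite s2 ?sm.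
Qed.

(** The descent starts from [upper_supp], whose support is a clique because all its edges are edges
    of $C(n,3)$. *)
Lemma cover_clique l : (forall i, 0 <= l i) ->
  exists m, [/\ forall i, 0 <= m i, same_mom l m, clique E (supp m),
    (#|supp m| <= 4)%N & forall b d, E b d -> ~~ crosses (supp m) b d].
Proof.
move=> l0; have [l' [l'0 sl [k hk]]] := upper_supp _ ht l l0.
have [|m [m0 sm cm m4 um]] := descend l' l'0; last first.
  by exists m; split=> // i i4; rewrite sl ?sm.
move=> x y /hk hx /hk hy xy.
have [x0|x0] := eqVneq (x : nat) 0%N; first exact: (adj_first _ pE).
have [yn|yn] := eqVneq y.+1 n; first exact: (adj_last _ pE).
by apply: (adj_succ _ pE); have := ltn_ord y; move: hx hy; rewrite (negbTE x0) (negbTE yn) /=; lia.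
Qed.

Definition node_poly S : {poly R} := \prod_(j in S) ('X - (t j)%:P).

(** For three nodes this is the equation of the plane through them, evaluated at the weighted point
    [l]. *)
Definition node_val S l : R := \sum_i l i * (node_poly S).[t i].

Lemma size_node_poly S : size (node_poly S) = #|S|.+1.
Proof. by rewrite /node_poly -big_enum size_prod_XsubC -cardE. Qed.

Lemma horner_node_poly S x : (node_poly S).[x] = \prod_(j in S) (x - t j).
Proof. by rewrite horner_prod; apply: eq_bigr => j _; rewrite hornerXsubC. Qed.

Lemma node_poly_eq0 S i : ((node_poly S).[t i] == 0) = (i \in S).
Proof.
rewrite horner_node_poly; apply/prodf_eq0/idP => [[j jS]|iS]; last first.
  by exists i; rewrite // subrr.
by rewrite subr_eq0 => /eqP/(t_inj _ ht)->.
Qed.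

Lemma node_val_same S l m : (#|S| <= 3)%N -> same_mom l m -> node_val S l = node_val S m.
Proof. by move=> S3 lm; apply: (same_mom_horner t); rewrite ?size_node_poly. Qed.

Lemma node_val_supp S l : supp l \subset S -> node_val S l = 0.
Proof.
move=> lS; apply: big1 => i _; have [/(subsetP lS)|/supp0->] := boolP (i \in supp l).
  by rewrite -node_poly_eq0 => /eqP->; rewrite mulr0.
by rewrite mul0r.
Qed.

Lemma node_val_supp1 S l r : supp l \subset S -> r \in S ->
  node_val (S :\ r) l = l r * (node_poly (S :\ r)).[t r].
Proof.
move=> lS rS; rewrite /node_val (bigD1 r) //= big1 ?addr0 // => i ir.
have [/(subsetP lS) iS|/supp0->] := boolP (i \in supp l); last by rewrite mul0r.
suff : (node_poly (S :\ r)).[t i] == 0 by move=> /eqP->; rewrite mulr0.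
by rewrite node_poly_eq0 !inE ir.
Qed.

(** Lagrange interpolation of X^k, k < 4, at the four nodes of [S]. The coefficients are the
    barycentric coordinates with respect to [S], possibly negative. *)
Lemma interpolate S l : #|S| = 4%N -> same_mom l (fun r =>
  if r \in S then node_val (S :\ r) l / (node_poly (S :\ r)).[t r] else 0).
Proof.
move=> S4 k k4.
pose c r := t r ^+ k / (node_poly (S :\ r)).[t r].
have lag : 'X^k = \sum_(r in S) c r *: node_poly (S :\ r).
  apply/eqP; rewrite -subr_eq0; apply/eqP.
  apply: (@roots_geq_poly_eq0 _ _ [seq t r | r <- enum S]).
  - apply/allP => _ /mapP[r + ->]; rewrite mem_enum => rS.
    rewrite /root hornerD hornerN hornerXn horner_sum (bigD1 r) //=.
    rewrite big1 => [|i /andP[iS ir]]; last first.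
      rewrite hornerZ; suff : (node_poly (S :\ i)).[t r] == 0 by move=> /eqP->; rewrite mulr0.
      by rewrite node_poly_eq0 !inE eq_sym ir.
    by rewrite addr0 hornerZ divfK ?subrr // node_poly_eq0 !inE eqxx.
  - by rewrite map_inj_uniq ?enum_uniq //; apply: t_inj.
  - rewrite size_map -cardE S4; apply: leq_trans (size_polyD _ _) _.
    rewrite size_polyN size_polyXn geq_max k4 /=.
    apply: leq_trans (size_sum _ _ _) _; apply/bigmax_leqP => r rS.
    apply: leq_trans (size_scale_leq _ _) _; rewrite size_node_poly.
    by move: S4; rewrite (cardsD1 r) rS /= add1n => -[->].
rewrite !momE [RHS]big_mkcond [RHS](bigID (mem S)) /= [X in _ = _ + X]big1; last first.
  by move=> r /negbTE->; rewrite mul0r.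
rewrite addr0; transitivity (\sum_i \sum_(r in S) l i * (c r * (node_poly (S :\ r)).[t i])).
  apply: eq_bigr => i _; rewrite -mulr_sumr; congr (_ * _).
  rewrite -hornerXn lag horner_sum; apply: eq_bigr => r _; exact: hornerZ.
rewrite exchange_big; apply: eq_bigr => r rS; rewrite rS /node_val.
rewrite 2!mulr_suml; apply: eq_bigr => i _; rewrite /c; ring.
Qed.

(** The variable is the perturbation parameter s: weight i is moved by s^(i+1). The exponents are
    distinct, to avoid cancellation, and positive, so that s = 0 gives back [l]. *)
Definition perturb l S : {poly R} :=
  \sum_i ((l i)%:P + 'X^(i.+1)) * ((node_poly S).[t i])%:P.

Lemma horner_perturb l S s : (perturb l S).[s] = node_val S (fun i => l i + s ^+ i.+1).
Proof.
rewrite horner_sum; apply: eq_bigr => i _.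
by rewrite hornerM hornerD !hornerC hornerXn.
Qed.

(** For i outside [S], the coefficient of degree i+1 is the value of [node_poly S] at [t i], which
    is nonzero. *)
Lemma perturb_neq0 l S : (#|S| < n)%N -> perturb l S != 0.
Proof.
move=> Sn; have [i iS] : exists i, i \notin S.
  apply/existsP; rewrite -negb_forall; apply: contraL Sn => /forallP allS.
  by rewrite -leqNgt -[X in (X <= _)%N]card_ord; apply/subset_leq_card/subsetP.
apply/eqP => /(congr1 (fun q : {poly R} => q`_i.+1)); rewrite coef_sum coef0.
rewrite (bigD1 i) //= big1 => [|j ji].
  rewrite coefMC coefD coefC coefXn eqxx add0r mul1r addr0 => /eqP.
  by rewrite node_poly_eq0 (negbTE iS).
by rewrite coefMC coefD coefC coefXn eqSS val_eqE [i == j]eq_sym (negbTE ji) addr0 mul0r.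
Qed.

(* After a generic perturbation the support has exactly 4 elements; the
   barycentric coordinates of the unperturbed point are nonnegative by
   continuity. *)
Lemma cover_uncrossed l : (4 <= n)%N -> (forall i, 0 <= l i) ->
  exists rho m, [/\ #|rho| = 4%N, clique E rho & forall b d, E b d -> ~~ crosses rho b d] /\
    [/\ forall i, 0 <= m i, supp m \subset rho & same_mom l m].
Proof.
move=> n4 l0.
have [s s0 hs] := horner_near0_seq [seq perturb l A | A : {set 'I_n}].
have {}hs S : (#|S| <= 3)%N ->
    node_val S (fun i => l i + s ^+ i.+1) != 0 /\
    0 <= node_val S l * node_val S (fun i => l i + s ^+ i.+1).
  move=> S3; have [|nz] := hs (perturb l S); first by apply/map_f; rewrite mem_enum.
  rewrite !horner_perturb => ge0; split.
    by rewrite -horner_perturb; apply: nz; apply: perturb_neq0; apply: leq_ltn_trans n4.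
  rewrite (_ : node_val S l = node_val S (fun i => l i + 0 ^+ i.+1)) //.
  by apply: eq_bigr => i _; rewrite expr0n addr0.
have [|m [m0 sm cm m4 um]] := cover_clique (fun i => l i + s ^+ i.+1).
  by move=> i; rewrite addr_ge0 // exprn_ge0 // ltW.
(* With at most three support points, [node_val] of the support would vanish at the perturbed point,
   against the choice of s. *)
have S4 : #|supp m| = 4%N.
  apply/eqP; rewrite eqn_leq m4 leqNgt; apply/negP => S3.
  by case: (hs (supp m) S3); rewrite (node_val_same _ _ m) // node_val_supp ?eqxx.
exists (supp m), (fun r => if r \in supp m
  then node_val (supp m :\ r) l / (node_poly (supp m :\ r)).[t r] else 0).
split=> //; split; last exact: interpolate.
  move=> r; case: ifP => // rS.
  have S3 : (#|supp m :\ r| <= 3)%N by move: S4; rewrite (cardsD1 r) rS /= add1n => -[->].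
  have [_] := hs _ S3; rewrite (node_val_same _ _ _ S3 sm) (node_val_supp1 (supp m) m) //.
  have mr : 0 < m r by rewrite lt_neqAle m0 andbT eq_sym; move: rS; rewrite inE.
  rewrite mulrCA pmulr_rge0 //; set x := node_val _ _; set y := _.[_] => xy.
  have -> : x / y = x * y * (y^-1) ^+ 2.
    have y0 : y != 0 by rewrite node_poly_eq0 !inE eqxx.
    by rewrite expr2 mulrA mulfK.
  by rewrite mulr_ge0 // sqr_ge0.
by apply/subsetP => r; rewrite inE; case: ifP => //; rewrite eqxx.
Qed.

End Cover.

(** * Triangulations *)

Lemma smin_le n (S : {set 'I_n}) i : i \in S -> (smin S <= i)%N.
Proof.
move=> iS; rewrite /smin -leEnat -minEnat.
exact: (@Order.TotalTheory.bigmin_le_cond _ _ _ n i (fun j => j \in S) (fun j : 'I_n => j : nat)).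
Qed.

Lemma smin_mem n (S : {set 'I_n}) i : i \in S -> exists2 x, x \in S & smin S = x.
Proof.
move=> iS; case: (arg_minnP (fun j : 'I_n => j : nat) iS) => x xS minx.
exists x; first exact: xS.
apply/eqP; rewrite eqn_leq smin_le //=; apply: (big_ind (fun v => x <= v)%N).
(* The default value n of the minimum exceeds every index. *)
- exact: ltnW.
- by move=> u v xu xv; rewrite leq_min xu.
- exact: minx.
Qed.

Lemma smax_ge n (S : {set 'I_n}) i : i \in S -> (i <= smax S)%N.
Proof. by move=> iS; apply: (leq_bigmax_cond (F := fun j : 'I_n => j : nat)). Qed.

Lemma smax_mem n (S : {set 'I_n}) i : i \in S -> exists2 x, x \in S & smax S = x.
Proof.
move=> iS; case: (arg_maxnP (fun j : 'I_n => j : nat) iS) => x xS maxx.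
exists x; first exact: xS.
by apply/eqP; rewrite eqn_leq smax_ge // andbT; apply/bigmax_leqP.
Qed.

Lemma card_ge4 n (S : {set 'I_n}) (a b c d : 'I_n) : (a < b)%N -> (b < c)%N ->
  (c < d)%N -> a \in S -> b \in S -> c \in S -> d \in S -> (3 < #|S|)%N.
Proof.
move=> ab bc cd aS bS cS dS.
have u : uniq [:: a; b; c; d].
  rewrite -(map_inj_uniq val_inj); apply: (@sorted_uniq _ ltn ltn_trans ltnn).
  by rewrite /= ab bc cd.
rewrite -[4%N]/(size [:: a; b; c; d]) -(card_uniqP u).
by apply/subset_leq_card/subsetP => x; rewrite !inE => /or4P[] /eqP->.
Qed.

Lemma card3_mem n (S : {set 'I_n}) (a b c x : 'I_n) : #|S| = 3%N -> (a < b)%N ->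
  (b < c)%N -> a \in S -> b \in S -> c \in S -> x \in S -> x \in [set a; b; c].
Proof.
move=> S3 ab bc aS bS cS xS; rewrite !inE -orbA.
have no4 (x1 x2 x3 x4 : 'I_n) : (x1 < x2)%N -> (x2 < x3)%N -> (x3 < x4)%N ->
    x1 \in S -> x2 \in S -> x3 \in S -> x4 \in S -> False.
  move=> l1 l2 l3 i1 i2 i3 i4.
  by have := card_ge4 _ _ _ _ _ _ l1 l2 l3 i1 i2 i3 i4; rewrite S3.
case: (ltngtP x a) => [xa|ax|/val_inj->]; last by rewrite eqxx.
  by case: (no4 x a b c).
case: (ltngtP x b) => [xb|bx|/val_inj->]; last by rewrite eqxx orbT.
  by case: (no4 a x b c).
case: (ltngtP x c) => [xc|cx|/val_inj->]; last by rewrite eqxx !orbT.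
  by case: (no4 a b x c).
by case: (no4 a b c x).
Qed.

(* Since [sigma] has the smallest minimum and, among the triangles sharing it,
   the largest maximum, a triangle crossing an edge of [sigma] interlaces
   [sigma]. *)
Lemma extremal_edge_uncrossed n (A B : {set 'I_n}) (b d : 'I_n) :
  #|A| = 3%N -> (smin A <= smin B)%N ->
  (smin A = smin B -> (smax B <= smax A)%N) -> ~ interlaced A B ->
  b \in A -> d \in A -> ~~ crosses B b d.
Proof.
move=> A3 leAB maxAB nAB bA dA; apply/negP => /crossesP[a [c [e [[aB cB eB] [ab bc cd de]]]]].
have [x xA xmin] := smin_mem _ _ _ bA.
have le_xa : (x <= a)%N by rewrite -xmin (leq_trans leAB) // smin_le.
move: le_xa; rewrite leq_eqVlt => /predU1P[xa|xa]; last first.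
  by apply: nAB; exists x, a, b, c, d, e; split.
have [z zA zmax] := smax_mem _ _ _ bA.
have le_ez : (e <= z)%N.
  rewrite -zmax (leq_trans (smax_ge _ _ _ eB)) // maxAB //.
  by apply/eqP; rewrite eqn_leq leAB xmin xa smin_le.
have : (3 < #|A|)%N by apply: (card_ge4 _ _ x b d z) => //; olia.
by rewrite A3.
Qed.

(** * From moments to convex hulls, overlaps and heights *)

Section Geometry.
Context {R : realFieldType} {n : nat} (t : 'I_n -> R).
Context (ht : forall i j : 'I_n, (i < j)%N -> t i < t j).
Implicit Types (l m w : 'I_n -> R) (A B rho : {set 'I_n}).
Local Notation mom := (mom t).
Local Notation same_mom := (same_mom t).

Lemma combE d l (j : 'I_d) : comb t d l 0 j = mom j.+1 l.
Proof. by rewrite summxE; apply: eq_bigr => i _; rewrite !mxE. Qed.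

Lemma mom0E l : mom 0 l = \sum_i l i.
Proof. by apply: eq_bigr => i _; rewrite expr0 mulr1. Qed.

Lemma comb_same_mom l m : \sum_i l i = 1 -> \sum_i m i = 1 ->
  comb t 3 l = comb t 3 m <-> same_mom l m.
Proof.
move=> l1 m1; split=> [lm [_|k k3]|lm]; first by rewrite !mom0E l1.
  by have /rowP/(_ (@Ordinal 3 k k3)) := lm; rewrite !combE.
by apply/rowP => j; rewrite !combE lm // ltnS.
Qed.

Lemma proj43_comb l : proj43 (comb t 4 l) = comb t 3 l.
Proof. by apply/rowP => j; rewrite mxE !combE. Qed.

Lemma conv_supp A l : conv_coeffs A l -> supp l \subset A.
Proof.
case=> _ [l0 _]; apply/subsetP => i; rewrite inE; apply: contraR => /l0 ->.
exact: eqxx.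
Qed.

(** The circuits on abcde and bcdef are combined into u so that the fourth moment cancels as well; u
    is positive on [A] and negative on [B]. Its two halves, divided by their common mass N,
    represent one point of both lifted triangles, whereas [A] and [B] are disjoint. *)
Lemma interlaced_overlap A B : #|A| = 3%N -> #|B| = 3%N -> interlaced A B ->
  overlap t 4 A B /\ overlap t 4 B A.
Proof.
move=> A3 B3 [a [b [c [d [e [f [[ab bc cd de ef] [[aA cA eA] [bB dB fB]]]]]]]]].
have memA x : x \in A = (x \in [set a; c; e]).
  apply/idP/idP => [|]; last by rewrite !inE -orbA => /or3P[] /eqP->.
  by apply: card3_mem => //; [apply: ltn_trans bc | apply: ltn_trans de].
have memB x : x \in B = (x \in [set b; d; f]).
  apply/idP/idP => [|]; last by rewrite !inE -orbA => /or3P[] /eqP->.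
  by apply: card3_mem => //; [apply: ltn_trans cd | apply: ltn_trans ef].
have disj x : x \in A -> x \notin B.
  rewrite memA memB !inE !negb_or -!val_eqE /=; move=> /orP[/orP[]|] /eqP ->;
    by do ?[apply/andP; split]; apply/eqP => E; olia.
have [w1 [w10 w14 w1p w1n]] := circuit _ ht _ _ _ _ _ ab bc cd de.
have [w2 [w20 w24 w2p w2n]] := circuit _ ht _ _ _ _ _ bc cd de ef.
pose u i := mom 4 w2 * w1 i - mom 4 w1 * w2 i.
have u0 k : (k < 5)%N -> mom k u = 0.
  rewrite ltnS leq_eqVlt momB !momZ => /predU1P[->|k4]; first by rewrite mulrC subrr.
  by rewrite (w10 _ k4) (w20 _ k4) !mulr0 subrr.
have uA i : i \in A -> 0 < u i.
  move=> iA; have iB := disj i iA; rewrite memA -w1p in iA; rewrite memB -w2p in iB.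
  by rewrite subr_gt0 (le_lt_trans (_ : _ <= 0)) ?mulr_gt0 // pmulr_rle0 // leNgt.
have uB i : i \in B -> u i < 0.
  move=> iB; have iA : i \notin A by apply: contraL iB => /disj.
  rewrite memB -w2p in iB; rewrite memA -w1p in iA.
  by rewrite subr_lt0 (le_lt_trans (_ : _ <= 0)) ?mulr_gt0 // pmulr_rle0 // leNgt.
have uAB i : i \notin A -> i \notin B -> u i = 0.
  move=> iA iB.
  have w1i : w1 i = 0.
    apply/eqP; rewrite eq_le leNgt w1p -memA iA leNgt w1n.
    by apply: contra iB; rewrite memB !inE => ->.
  have w2i : w2 i = 0.
    apply/eqP; rewrite eq_le leNgt w2p -memB iB leNgt w2n.
    by apply: contra iA; rewrite memA !inE -orbA => ->; rewrite orbT.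
  by rewrite /u w1i w2i !mulr0 subrr.
pose N := \sum_(i in A) u i.
have N0 : 0 < N.
  rewrite /N (bigD1 a) //= ltr_pwDl ?uA //.
  by apply: sumr_ge0 => i /andP[/uA/ltW].
pose l i := if i \in A then u i / N else 0.
pose m i := if i \in B then - u i / N else 0.
have lmu i : l i - m i = N^-1 * u i.
  rewrite /l /m; case: ifP => [/disj/negbTE->|/negbT iA]; first by rewrite subr0 mulrC.
  by case: ifP => [_|/negbT iB]; [rewrite mulNr opprK add0r mulrC | rewrite uAB // mulr0 subrr].
have lm k : (k < 5)%N -> mom k l = mom k m.
  move=> k5; apply/eqP; rewrite -subr_eq0 -momB.
  rewrite (_ : mom k _ = mom k (fun i => N^-1 * u i)); last first.
    by apply: eq_bigr => i _; rewrite lmu.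
  by rewrite momZ u0 // mulr0.
have l1 : \sum_i l i = 1.
  by rewrite -big_mkcond -mulr_suml divff // gt_eqF.
have cl : conv_coeffs A l.
  split; last by split=> // i /negbTE iA; rewrite /l iA.
  by move=> i; rewrite /l; case: ifP => // /uA ui; rewrite divr_ge0 // ltW.
have cm : conv_coeffs B m.
  split; last split.
  - by move=> i; rewrite /m; case: ifP => // /uB ui; rewrite divr_ge0 ?oppr_ge0 // ltW.
  - by move=> i /negbTE iB; rewrite /m iB.
  - by rewrite -mom0E -lm // mom0E.
have no_conv S : S = set0 -> ~ in_conv t 4 S (comb t 4 l).
  move=> -> [z [[_ [z0 z1]] _]]; move/eqP: z1.
  rewrite big1 => [|i _]; first by rewrite eq_sym oner_eq0.
  by rewrite z0 // inE.
have dis : A :&: B = set0.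
  by apply/setP => x; rewrite !inE; apply/negP => /andP[/disj/negP].
have lmE : comb t 4 l = comb t 4 m by apply/rowP => j; rewrite !combE lm // ltnS.
split; exists (comb t 4 l).
  by split; [exists l | split; [exists m | apply: no_conv]].
by split; [exists m | split; [exists l | apply: no_conv; rewrite setIC]].
Qed.

(** If l and m differed, [same_mom_eq] would give five alternating indices a < b < c < d < e, with b
    and d in one clique and a, c, e in the other, which would then be crossed by the edge bd. *)
Lemma uncrossed_same_mom (E : rel 'I_n) A B l m :
  (forall i, 0 <= l i) -> (forall i, 0 <= m i) ->
  supp l \subset A -> supp m \subset B -> clique E A -> clique E B ->
  (forall b d, E b d -> ~~ crosses A b d) -> (forall b d, E b d -> ~~ crosses B b d) ->
  same_mom l m -> l =1 m.
Proof.
move=> l0 m0 /subsetP lA /subsetP mB cA cB uA uB lm; apply: (same_mom_eq t) => //.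
  case/(alternates_supp l m l0 m0)=> a [b [c [d [e [[ab bc cd de] [[la lc le] [mb md]]]]]]].
  have /uA/negP[] : E b d by apply: cB; rewrite ?mB // (ltn_trans bc).
  by apply/crossesP; exists a, c, e; split; split; auto.
case/(alternates_supp m l m0 l0)=> a [b [c [d [e [[ab bc cd de] [[ma mc me] [lb ld]]]]]]].
have /uB/negP[] : E b d by apply: cA; rewrite ?lA // (ltn_trans bc).
by apply/crossesP; exists a, c, e; split; split; auto.
Qed.

Definition triangulation_of (E : rel 'I_n) : {set {set 'I_n}} :=
  [set rho : {set 'I_n} | [&& #|rho| == 4%N,
     [forall i in rho, forall j in rho, (i < j)%N ==> E i j] &
     [forall b, forall d, E b d ==> ~~ crosses rho b d]]].

Lemma triangulation_ofP E rho : reflect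
  [/\ #|rho| = 4%N, clique E rho & forall b d, E b d -> ~~ crosses rho b d]
  (rho \in triangulation_of E).
Proof.
rewrite inE; apply: (iffP and3P) => [[/eqP r4 /forall_inP cl /forallP un]|[r4 cl un]].
  split=> // [i j ir jr ij|b d]; last by move: (un b) => /forallP/(_ d)/implyP.
  by have /forall_inP/(_ j jr)/implyP := cl i ir; apply.
split; first exact/eqP.
  by apply/forall_inP => i ir; apply/forall_inP => j jr; apply/implyP/cl.
by apply/forallP => b; apply/forallP => d; apply/implyP/un.
Qed.

Context {E : rel 'I_n} (pE : persistent E) (n4 : (4 <= n)%N).

(** Covering is [cover_uncrossed]. A common point of two members has the same coefficients in both
    by [uncrossed_same_mom], so these live on the intersection. *)
Lemma triangulation_of_persistent : triangulation t (triangulation_of E).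
Proof.
split; first by move=> rho /triangulation_ofP[].
split=> [p [l [[l0 [_ l1]] ->]]|rho rho' /triangulation_ofP[r4 cl un] /triangulation_ofP[r4' cl' un'] _].
  have [rho [m [[r4 cl un] [m0 sub sm]]]] := cover_uncrossed _ ht pE l n4 l0.
  exists rho; first exact/triangulation_ofP.
  have m1 : \sum_i m i = 1 by rewrite -mom0E -sm // mom0E.
  exists m; split; last exact/comb_same_mom.
  by split=> //; split=> // i; apply: contraNeq => mi; apply: (subsetP sub); rewrite inE.
case=> p [[l [cfl ->]] [[m [cfm lm]] []]].
have [[l0 [lr l1]] [m0 [mr m1]]] := (cfl, cfm).
have lmE : l =1 m.
  apply: (uncrossed_same_mom E rho rho') => //; try exact: conv_supp.
  exact/comb_same_mom.
exists l; split=> //; split=> //; split=> // i.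
by rewrite inE negb_and => /orP[/lr|/mr]; rewrite ?lmE.
Qed.

(** Some member [rho] covers the sum of the vertices of [A]. Uniqueness of the representation puts
    all of [A] in [rho]. *)
Lemma uncrossed_simplex_of A : A != set0 -> clique E A ->
  (forall b d, E b d -> ~~ crosses A b d) -> simplex_of A (triangulation_of E).
Proof.
move=> A0 cA uA; pose l i : R := (i \in A)%:R.
have l0 i : 0 <= l i by apply: ler0n.
have [rho [m [[r4 cl un] [m0 sub sm]]]] := cover_uncrossed _ ht pE l n4 l0.
exists rho; first exact/triangulation_ofP.
have lA : supp l \subset A by apply/subsetP => i; rewrite inE /l; case: (i \in A); rewrite ?eqxx.
have lm : l =1 m by apply: (uncrossed_same_mom E A rho).
apply: subset_trans sub; apply/subsetP => i iA.
by rewrite inE -lm /l iA oner_eq0.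
Qed.

(** Unless l = m, [mom4_lt0] puts l strictly below m; the five alternating signs that it excludes
    would make an edge bd of [rho] cross [A]. *)
Lemma uncrossed_le4 A : (forall b d, E b d -> ~~ crosses A b d) ->
  le4 t A (triangulation_of E).
Proof.
move=> uA _ _ [l [cfl [<- <-]]] rho _ /triangulation_ofP[_ cl _] [m [cfm [+ <-]]].
rewrite !proj43_comb !combE /=.
have [[l0 [lr l1]] [m0 [mr m1]]] := (cfl, cfm).
move/esym/(comb_same_mom _ _ l1 m1) => lm.
have [/existsP[i lmi]|/existsPn eq_lm] := boolP [exists i, l i - m i != 0]; last first.
  rewrite (_ : mom 4 l = mom 4 m) //; apply: eq_bigr => i _.
  by have := eq_lm i; rewrite negbK subr_eq0 => /eqP->.
rewrite -subr_le0 -momB; apply/ltW/(mom4_lt0 t) => //; last by exists i.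
  by move=> k k4; rewrite momB lm ?subrr.
case/(alternates_supp l m l0 m0)=> a [b [c [d [e [[ab bc cd de] [[la lc le] [mb md]]]]]]].
have /subsetP lA := conv_supp _ _ cfl; have /subsetP mrho := conv_supp _ _ cfm.
have /uA/negP[] : E b d by apply: cl; rewrite ?mrho // (ltn_trans bc).
by apply/crossesP; exists a, c, e; split; split; auto.
Qed.

End Geometry.

Theorem theorem3p2 (R : realFieldType) (n : nat) (t : 'I_n -> R)
  (hn : (4 <= n)%N)
  (ht : forall i j : 'I_n, (i < j)%N -> t i < t j)
  (m : nat) (sigma : {set 'I_n}) (tau : 'I_m -> {set 'I_n})
  (hsig : #|sigma| = 3%N) (htau : forall i, #|tau i| = 3%N)
  (hdist1 : forall i, sigma != tau i)
  (hdist2 : injective tau)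
  (hov1 : forall i, ~ overlap t 4 sigma (tau i))
  (hov2 : forall i j, i != j -> ~ overlap t 4 (tau i) (tau j))
  (hmin : forall i, (smin sigma <= smin (tau i))%N)
  (hmax : forall i, smin sigma = smin (tau i) -> (smax (tau i) <= smax sigma)%N) :
  exists2 T : {set {set 'I_n}}, triangulation t T &
    simplex_of sigma T /\ (forall i, le4 t (tau i) T).
Proof.
pose F := sigma |: [set tau i | i : 'I_m].
have sigF : sigma \in F by rewrite in_setU1 eqxx.
have tauF i : tau i \in F by rewrite in_setU1; apply/orP; right; apply: imset_f.
have F3 A : A \in F -> #|A| = 3%N.
  by rewrite in_setU1 => /predU1P[->|/imsetP[i _ ->]].
have noF : {in F &, forall A B, ~ interlaced A B}.
  move=> A B FA FB iAB; have [EAB|neAB] := eqVneq A B.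
    move: iAB; rewrite -EAB => -[a [b [c [d [e [f [[ab bc cd de _] [[aA cA eA] [bA dA _]]]]]]]]].
    have : (3 < #|A|)%N by apply: (card_ge4 _ A a b c d).
    by rewrite F3.
  (* Both orders are required: [hov1] has [sigma] as first argument, while either of [A] and [B] may
     be [sigma]. *)
  have [oAB oBA] := interlaced_overlap t ht A B (F3 _ FA) (F3 _ FB) iAB.
  move: FA FB; rewrite !in_setU1 => /predU1P[EA|/imsetP[i _ EA]] /predU1P[EB|/imsetP[j _ EB]].
  - by rewrite EA EB eqxx in neAB.
  - by apply: (hov1 j); rewrite -EA -EB.
  - by apply: (hov1 i); rewrite -EA -EB.
  - apply: (hov2 i j); last by rewrite -EA -EB.
    by apply: contraNneq neAB => ij; rewrite EA EB ij.
have pE := uncrossed_persistent F noF.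
have unF A : A \in F -> forall b d, uncrossed F b d -> ~~ crosses A b d.
  by move=> FA b d Ebd; apply: uncrossedP FA.
exists (triangulation_of (uncrossed F)); first exact: triangulation_of_persistent.
split; last by move=> i; apply: uncrossed_le4 => //; apply: unF.
apply: (uncrossed_simplex_of t) => //; [by rewrite -card_gt0 hsig| |exact: unF].
(* As [sigma] belongs to [F], its edges must be uncrossed by [sigma] itself too; the same lemma
   applies with both sets equal to [sigma]. *)
move=> b d bs ds bd; apply/andP; split=> //; apply/forall_inP => A.
rewrite in_setU1 => /predU1P[->|/imsetP[i _ ->]].
  by apply: (extremal_edge_uncrossed _ sigma) => //; apply: noF.
by apply: (extremal_edge_uncrossed _ sigma) => //; [apply: hmax | apply: noF].
Qed.
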